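(* Let $k,p,q$ be fixed nonnegative integers, and for each $n$ let $\mathcal{F}=\mathcal{F}_n\subseteq\binom{[n]}{k}$ be an intersecting family. If $\tau(\mathcal{F})\le q$, then $\beta_{p,q}(\mathcal{F})=0$. If $\tau(\mathcal{F})>q$, then $\beta_{p,q}(\mathcal{F})=O(n^{k-p-\tau(\mathcal{F})})$, where the implied constant depends only on $k,p,q$ (and the bound holds for all sufficiently large $n$).
   Context: $[n]=\{1,\dots,n\}$ and $\binom{[n]}{k}$ is the family of all $k$-subsets of $[n]$. A family $\mathcal{F}$ of sets is intersecting if $F\cap F'\neq\emptyset$ for all $F,F'\in\mathcal{F}$. For a family $\mathcal{F}$ and disjoint sets $A,B$, let $\mathcal{F}(A,\overline{B})=\{F\in\mathcal{F}: A\subseteq F,\ B\cap F=\emptyset\}$. For $\mathcal{F}\subseteq 2^{[n]}$, the $(p,q)$-dömdödöm is $\beta_{p,q}(\mathcal{F})=\min\{|\mathcal{F}(A,\overline{B})|: |A|=p,\ |B|=q,\ A\cap B=\emptyset,\ A,B\subseteq[n]\}$. The covering number $\tau(\mathcal{F})$ is the minimum size of a set $X$ with $X\cap F\neq\emptyset$ for every $F\in\mathcal{F}$. *)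

(* Defs.v *)
From mathcomp Require Import all_boot.
Set Implicit Arguments.
Unset Strict Implicit.
Unset Printing Implicit Defensive.

(* The ground set [n] = {1, ..., n} is represented by 'I_n = {0, ..., n - 1}. *)

Definition ksubsets (n k : nat) : {set {set 'I_n}} :=
  [set S : {set 'I_n} | #|S| == k].

(* S = S' is allowed, so an intersecting family never contains set0. *)
Definition intersecting (n : nat) (F : {set {set 'I_n}}) : Prop :=
  {in F &, forall S S' : {set 'I_n}, S :&: S' != set0}.

Definition restriction (n : nat) (F : {set {set 'I_n}}) (A B : {set 'I_n}) :
    {set {set 'I_n}} :=
  [set S in F | (A \subset S) && (B :&: S == set0)].

Definition admissible (n p q : nat) (A B : {set 'I_n}) : bool :=
  [&& #|A| == p, #|B| == q & A :&: B == set0].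

(* The initial value #|F| bounds every term: this is the minimum of the terms as    *)
(* soon as there is an admissible pair, i.e. p + q <= n (see betaP).          *)
Definition beta (n p q : nat) (F : {set {set 'I_n}}) : nat :=
  \big[minn/#|F|]_(AB : {set 'I_n} * {set 'I_n} | admissible p q AB.1 AB.2)
    #|restriction F AB.1 AB.2|.

Definition covers (n : nat) (F : {set {set 'I_n}}) (X : {set 'I_n}) : bool :=
  [forall S in F, X :&: S != set0].

(* The initial value n bounds every term: this is the minimum size of a cover as    *)
(* soon as a cover exists, i.e. set0 \notin F (see tauP).                     *)
Definition tau (n : nat) (F : {set {set 'I_n}}) : nat :=
  \big[minn/n]_(X : {set 'I_n} | covers F X) #|X|.

Lemma bigminnP (I : finType) (P : pred I) (f : I -> nat) (m : nat) :
    (exists i, P i) -> (forall i, P i -> f i <= m) ->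
  (exists2 i, P i & f i = \big[minn/m]_(j | P j) f j) /\
  (forall i, P i -> \big[minn/m]_(j | P j) f j <= f i).
Proof.
move=> [i0 Pi0] lem.
have lb i : P i -> \big[minn/m]_(j | P j) f j <= f i.
  move=> Pi; rewrite -big_filter.
  have: i \in [seq j <- index_enum I | P j] by rewrite mem_filter Pi mem_index_enum.
  elim: [seq j <- _ | _] => // j s IHs; rewrite big_cons inE geq_min.
  by case/predU1P=> [->|/IHs->]; rewrite ?leqnn ?orbT.
split=> //.
have [|eq_m] : (exists2 i, P i & f i = \big[minn/m]_(j | P j) f j) \/
    \big[minn/m]_(j | P j) f j = m; first last.
- exists i0 => //; apply/eqP; rewrite eqn_leq lb // andbT.
  by rewrite eq_m lem.
- by [].
elim/big_ind: _ => [|a b Ha Hb|i Pi]; [by right | | by left; exists i].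
by rewrite /minn; case: ifP.
Qed.

Lemma betaP (n p q : nat) (F : {set {set 'I_n}}) : p + q <= n ->
  (exists A B : {set 'I_n},
     admissible p q A B /\ #|restriction F A B| = beta p q F) /\
  (forall A B : {set 'I_n},
     admissible p q A B -> beta p q F <= #|restriction F A B|).
Proof.
move=> lepqn.
have ex_sub (D : {set 'I_n}) m : m <= #|D| ->
    exists2 A : {set 'I_n}, A \subset D & #|A| = m.
  rewrite -bin_gt0 -cards_draws card_gt0 => /set0Pn[A].
  by rewrite inE => /andP[sAD /eqP cardA]; exists A.
have [|AB _|[[A B] /= admAB eqAB] lb] := @bigminnP _
    (fun AB : {set 'I_n} * {set 'I_n} => admissible p q AB.1 AB.2)
    (fun AB => #|restriction F AB.1 AB.2|) #|F|.
- have [|A _ cardA] := ex_sub setT p.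
    by rewrite cardsT card_ord (leq_trans (leq_addr q p)).
  have [|B sBA cardB] := ex_sub (~: A) q.
    by rewrite cardsCs setCK card_ord cardA leq_subRL ?(leq_trans (leq_addr q p)).
  exists (A, B); rewrite /admissible /= cardA cardB !eqxx /= setI_eq0.
  by rewrite disjoints_subset -setCS setCK.
- by apply/subset_leq_card/subsetP=> S; rewrite inE => /andP[].
by split=> [|A' B' /(lb (A', B'))//]; exists A, B.
Qed.

Lemma tauP (n : nat) (F : {set {set 'I_n}}) : set0 \notin F ->
  (exists2 X : {set 'I_n}, covers F X & #|X| = tau F) /\
  (forall X : {set 'I_n}, covers F X -> tau F <= #|X|).
Proof.
move=> F'0; apply: bigminnP => [|X _]; last by rewrite -[leqRHS]card_ord max_card.
exists setT; apply/forall_inP=> S FS; rewrite setTI.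
by apply: contraNneq F'0 => <-.
Qed.

(* Main.v *)
(* If a set X has fewer than tau F elements, some member S0 of F avoids X, while    *)
(* every member of F containing X meets S0; so the members containing X are covered *)
(* by the k families of members containing x |: X, for x in S0.  Iterating tau F    *)
(* times from X = set0 gives |F| <= k ^ tau F * n ^ (k - tau F).  The number of     *)
(* members of F containing A, averaged over all p-subsets A, is                     *)
(* 'C(k, p) |F| / 'C(n, p) = O(n ^ (k - p - tau F)); B may be any q-set disjoint    *)
(* from A.                                                                          *)

Require Import Defs.
From mathcomp Require Import all_boot all_order all_algebra.
Set Implicit Arguments.
Unset Strict Implicit.
Unset Printing Implicit Defensive.
Import GRing.Theory Num.Theory.

(** When [tau F <= q], a minimum cover fits inside [B], and no member of [F] avoids it ([beta_eq0]).
    For the bound, [card_members_containing] carries the branching that controls [#|F|], and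
    [beta_bin_le] the averaging over [p]-sets; [beta_exp_le] combines them with a constant that
    depends only on [k] and [p]. *)

Lemma exists_subset_card (T : finType) (D : {set T}) (m : nat) :
  m <= #|D| -> exists2 A : {set T}, A \subset D & #|A| = m.
Proof.
rewrite -bin_gt0 -cards_draws card_gt0 => /set0Pn[A].
by rewrite inE => /andP[sAD /eqP cardA]; exists A.
Qed.

Lemma leq_ffact_exp (n m : nat) : n ^_ m <= n ^ m.
Proof.
by elim: m => // m IHm; rewrite ffactnSr expnSr leq_mul ?leq_subr.
Qed.

Lemma leq_bin_exp (n m : nat) : 'C(n, m) <= n ^ m.
Proof.
apply: leq_trans (leq_ffact_exp n m).
by rewrite -bin_ffact leq_pmulr ?fact_gt0.
Qed.

(** Each factor [n - i] of the falling factorial, with [i < m], is at least half of [n]. *)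
Lemma leq_exp_ffact (n m : nat) : m.*2 <= n -> n ^ m <= 2 ^ m * n ^_ m.
Proof.
elim: m => // m IHm le_m; rewrite ffactnSr !expnSr mulnACA.
have le2m : m.*2 <= n by apply: leq_trans le_m; rewrite leq_double.
rewrite leq_mul ?IHm // mul2n doubleB leq_subRL.
  by rewrite -[n.*2]addnn leq_add2r.
by apply: leq_trans le2m _; rewrite -addnn leq_addr.
Qed.

(** [S :\: X] determines [S] once [X \subset S], and it has [k - #|X|] elements. *)
Lemma card_ksubsets_containing (n k : nat) (X : {set 'I_n}) :
  #|[set S in ksubsets n k | X \subset S]| <= n ^ (k - #|X|).
Proof.
apply: leq_trans (leq_bin_exp _ _).
have -> : 'C(n, k - #|X|) = 'C(#|[set: 'I_n]|, k - #|X|) by rewrite cardsT card_ord.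
rewrite -cards_draws.
have inj : {in [set S in ksubsets n k | X \subset S] &,
    injective (fun S : {set 'I_n} => S :\: X)}.
  move=> S S' /setIdP[_ sXS] /setIdP[_ sXS'] /= eqSS'.
  rewrite -[LHS](setID S X) -[RHS](setID S' X) eqSS'.
  by rewrite (setIidPr sXS) (setIidPr sXS').
rewrite -(card_in_imset inj); apply/subset_leq_card/subsetP=> _ /imsetP[S + ->].
rewrite !inE subsetT => /andP[/eqP cardS sXS].
by rewrite cardsD (setIidPr sXS) cardS /=.
Qed.

Section Intersecting.

Variables (n k : nat) (F : {set {set 'I_n}}).
Hypotheses (sFk : F \subset ksubsets n k) (interF : intersecting F).

Lemma card_member S : S \in F -> #|S| = k.
Proof. by move/(subsetP sFk); rewrite inE => /eqP. Qed.

Lemma set0_notin_intersecting : set0 \notin F.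
Proof. by apply/negP=> F0; have := interF F0 F0; rewrite setI0 eqxx. Qed.

(** In an intersecting family every member is itself a cover. *)
Lemma tau_le_member S : S \in F -> tau F <= k.
Proof.
move=> FS; rewrite -(card_member FS).
apply: (tauP set0_notin_intersecting).2; apply/forall_inP=> S' FS'.
exact: interF.
Qed.

(** [j] counts the branchings still to be made. Each one adds a point to [X] and costs a factor [k],
    so [#|X| + j], and with it the exponent of [n], stays constant. *)
Lemma card_members_containing (j : nat) (X : {set 'I_n}) : #|X| + j <= tau F ->
  #|[set S in F | X \subset S]| <= k ^ j * n ^ (k - (#|X| + j)).
Proof.
elim: j X => [|j IHj] X leXt.
  rewrite addn0 mul1n; apply: leq_trans (card_ksubsets_containing k X).
  apply/subset_leq_card/subsetP=> S; rewrite !inE => /andP[FS ->].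
  by rewrite (card_member FS) eqxx.
have: ~~ covers F X.
  apply: contraL leXt => /(tauP set0_notin_intersecting).2 leXt.
  by rewrite -ltnNge addnS ltnS (leq_trans leXt) ?leq_addr.
rewrite negb_forall_in => /exists_inP[S0 FS0]; rewrite negbK => XS0.
have le_bigcup :
    #|[set S in F | X \subset S]|
      <= #|\bigcup_(x in S0) [set S in F | x |: X \subset S]|.
  apply/subset_leq_card/subsetP=> S; rewrite inE => /andP[FS sXS].
  have /set0Pn[x /setIP[S0x Sx]] := interF FS0 FS.
  by apply/bigcupP; exists x => //; rewrite inE FS subUset sub1set Sx.
apply: leq_trans le_bigcup _.
have le_sum : \sum_(x in S0) #|[set S in F | x |: X \subset S]|
    <= \sum_(x in S0) k ^ j * n ^ (k - (#|X| + j.+1)).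
  apply: leq_sum => x S0x.
  have X'x : x \notin X.
    by apply: contraTN XS0 => Xx; apply/set0Pn; exists x; rewrite inE Xx.
  have cardxX : #|x |: X| = #|X|.+1 by rewrite cardsU1 X'x.
  by rewrite -addSnnS -cardxX IHj // cardxX addSnnS.
rewrite sum_nat_const (card_member FS0) mulnA -expnS in le_sum.
apply: leq_trans le_sum.
apply: (big_ind2 (fun (U : {set {set 'I_n}}) m => #|U| <= m)).
- by rewrite cards0.
- move=> U a V b leU leV; apply: leq_trans (leq_card_setU U V) _.
  exact: leq_add.
- by [].
Qed.

Lemma card_intersecting_le : #|F| <= k ^ tau F * n ^ (k - tau F).
Proof.
have := @card_members_containing (tau F) set0.
rewrite cards0 add0n => /(_ (leqnn _)); apply: leq_trans.
by apply/subset_leq_card/subsetP=> S FS; rewrite inE FS sub0set.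
Qed.

(** Double counting of the pairs [A \subset S] with [S] in [F]. *)
Lemma sum_card_members_containing (p : nat) :
  \sum_(A : {set 'I_n} | #|A| == p) #|[set S in F | A \subset S]|
    = #|F| * 'C(k, p).
Proof.
under eq_bigr => A _ do rewrite -sum1_card.
rewrite (exchange_big_dep (mem F)) /=; last by move=> A S _; rewrite inE => /andP[].
rewrite -sum_nat_const; apply: eq_bigr => S FS.
rewrite -(card_member FS) -cards_draws -sum1_card.
by apply: eq_bigl => A; rewrite !inE FS andbC.
Qed.

Lemma beta_bin_le (p q : nat) : p + q <= n ->
  beta p q F * 'C(n, p) <= #|F| * 'C(k, p).
Proof.
move=> lepqn; rewrite -sum_card_members_containing.
have -> : 'C(n, p) = \sum_(A : {set 'I_n} | #|A| == p) 1.
  have -> : 'C(n, p) = 'C(#|[set: 'I_n]|, p) by rewrite cardsT card_ord.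
  rewrite sum1dep_card -cards_draws.
  by apply: eq_card => A; rewrite !inE subsetT.
rewrite big_distrr; apply: leq_sum => A /eqP cardA; rewrite /= muln1.
have [|B sBA cardB] := @exists_subset_card _ (~: A) q.
  by rewrite cardsCs setCK card_ord cardA leq_subRL ?(leq_trans (leq_addr q p)).
have admAB : admissible p q A B.
  by rewrite /admissible cardA cardB !eqxx setI_eq0 disjoint_sym disjoints_subset.
apply: leq_trans ((betaP F lepqn).2 A B admAB) _.
by apply/subset_leq_card/subsetP=> S; rewrite !inE => /and3P[-> ->].
Qed.

Lemma beta_exp_le (p q : nat) : p + q <= n -> p.*2 <= n ->
  beta p q F * n ^ p
    <= 2 ^ p * p`! * 'C(k, p) * k.+1 ^ k * n ^ (k - tau F).
Proof.
move=> lepqn le2pn; have [->|[S FS]] := set_0Vmem F.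
  have [[A [B [_ <-]]] _] := betaP set0 lepqn.
  suff -> : restriction set0 A B = set0 by rewrite cards0.
  by apply/setP=> S; rewrite !inE.
(* The positive base [k.+1] lets the exponent [tau F] grow to [k], so that this factor no longer
   depends on [F]. *)
have leF : #|F| <= k.+1 ^ k * n ^ (k - tau F).
  apply: leq_trans card_intersecting_le _; rewrite leq_mul2r; apply/orP; right.
  have tau_k := tau_le_member FS.
  case: (posnP (tau F)) => [->|tau_gt0]; first by rewrite expn_gt0.
  by apply: leq_trans (leq_pexp2l _ tau_k); rewrite ?leq_exp2r.
apply: leq_trans (leq_mul (leqnn _) (leq_exp_ffact le2pn)) _.
rewrite -bin_ffact.
have -> : beta p q F * (2 ^ p * ('C(n, p) * p`!))
    = 2 ^ p * p`! * (beta p q F * 'C(n, p)).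
  by rewrite mulnCA (mulnC 'C(n, p)) -!mulnA [beta p q F * _]mulnCA.
rewrite -!mulnA !leq_mul2l; do 2!(apply/orP; right).
apply: leq_trans (beta_bin_le lepqn) _.
by rewrite mulnC leq_mul2l leF orbT.
Qed.

End Intersecting.

Lemma beta_eq0 (n p q : nat) (F : {set {set 'I_n}}) :
  set0 \notin F -> p + q <= n -> tau F <= q -> beta p q F = 0.
Proof.
move=> F'0 lepqn; have [[X coverX <-] _] := tauP F'0 => leXq.
have leqn : q <= n := leq_trans (leq_addl p q) lepqn.
(* [D] is the complement of the future [B]: [~: D] is a [q]-set containing the cover [X], and [A] is
   then chosen inside [D]. *)
have [|D sDX cardD] := @exists_subset_card _ (~: X) (n - q).
  by rewrite cardsCs setCK card_ord leq_sub2l.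
have [|A sAD cardA] := @exists_subset_card _ D p.
  by rewrite cardD leq_subRL // addnC.
have admA : admissible p q A (~: D).
  rewrite /admissible cardA cardsCs setCK card_ord cardD subKn // !eqxx /=.
  by rewrite setI_eq0 disjoints_subset setCK.
have := (betaP F lepqn).2 A _ admA.
suff -> : restriction F A (~: D) = set0 by rewrite cards0 leqn0 => /eqP.
apply/setP=> S; rewrite !inE; apply/and3P=> -[FS _ /eqP DS0].
have /set0Pn[x /setIP[Xx Sx]] := forall_inP coverX S FS.
have : x \in ~: D :&: S.
  by rewrite !inE Sx andbT; apply: contraL Xx => /(subsetP sDX); rewrite inE.
by rewrite DS0 inE.
Qed.

Theorem theorem1p2 (k p q : nat) :
  (forall (n : nat) (F : {set {set 'I_n}}),
     F \subset ksubsets n k -> intersecting F -> p + q <= n ->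
     tau F <= q -> beta p q F = 0) /\
  (exists (C : rat) (N : nat), forall (n : nat) (F : {set {set 'I_n}}),
     N <= n -> F \subset ksubsets n k -> intersecting F ->
     q < tau F ->
     ((beta p q F)%:R <= C * n%:R ^ (k%:Z - p%:Z - (tau F)%:Z) :> rat)%R).
Proof.
split=> [n F _ interF|]; first exact/beta_eq0/set0_notin_intersecting.
(* The threshold gives [p.*2 <= n] and [p + q <= n]; the successor makes [n] positive, as the
   possibly negative exponent requires. *)
exists (2 ^ p * p`! * 'C(k, p) * k.+1 ^ k)%:R%R, (p.*2 + q).+1.
move=> n F ltn sFk interF lt_tau.
have n_gt0 : 0 < n by apply: leq_ltn_trans ltn.
have le2pn : p.*2 <= n by apply: leq_trans (leq_addr _ _) (ltnW ltn).
have lepqn : p + q <= n.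
  by apply: leq_trans (ltnW ltn); rewrite leq_add2r -addnn leq_addr.
have le_tau : tau F <= k.
  (* An empty family is covered by [set0], which contradicts [q < tau F]. *)
  have [F0|[S FS]] := set_0Vmem F; last exact: (tau_le_member sFk interF FS).
  have /(tauP (set0_notin_intersecting interF)).2 : covers F set0.
    by apply/forall_inP=> S; rewrite F0 inE.
  by rewrite cards0 leqNgt (leq_ltn_trans _ lt_tau).
have nn0 : (n%:R != 0 :> rat)%R by rewrite pnatr_eq0 -lt0n.
have np_gt0 : (0 < n%:R ^+ p :> rat)%R by rewrite exprn_gt0 // ltr0n.
(* Only subtracting [p] can make the exponent negative; [n ^ p] moves to the left, leaving an
   inequality in [nat]. *)
have -> : (k%:Z - p%:Z - (tau F)%:Z = (k - tau F)%:Z - p%:Z)%R.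
  by rewrite -subzn // addrAC.
rewrite expfzDr // -invr_expz mulrA ler_pdivlMr // -!exprnP -!natrX -!natrM ler_nat.
exact: beta_exp_le.
Qed.
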